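(* Let $E$ be a finite set, $g\colon\mathbb{Z}^E\to\mathbb{R}\cup\{+\infty\}$ an M$^\natural$-convex function with bounded effective domain $\operatorname{dom} g$, given by an evaluation oracle together with one initial point of $\operatorname{dom} g$, and let $b\colon E\to\{0,1\}$. Let $T$ denote the time of a single evaluation of $g$ and let $L:=\max\{\|x-y\|_\infty \mid x,y\in\operatorname{dom} g\}$. Then the entire Pareto optimal value set of the biobjective problem $$\min\ (g(x),\langle b,x\rangle)\quad\text{s.t. } x\in\operatorname{dom} g$$ can be computed in $O(|E|^3\, L\, T)$ time. If moreover $\operatorname{dom} g\subseteq\{0,1\}^E$ and $r:=\max\{\|x\|_1\mid x\in\operatorname{dom} g\}$, then the entire Pareto optimal value set can be computed in $O(r|E|^2\,T)$ time.
   Context: $\langle b,x\rangle:=\sum_{e\in E}b(e)x(e)$. $\operatorname{dom} g=\{x\in\mathbb{Z}^E\mid g(x)\in\mathbb{R}\}$. For a vector $x$, $\operatorname{supp}(x)=\{e\mid x(e)>0\}$; $\chi_e$ is the unit vector of $e\in E$. A function $g\colon\mathbb{Z}^E\to\mathbb{R}\cup\{+\infty\}$ with $\operatorname{dom} g\neq\varnothing$ is M$^\natural$-convex if for all $x,y\in\operatorname{dom} g$ and $u\in\operatorname{supp}(x-y)$, either (i) $g(x)+g(y)\ge g(x-\chi_u)+g(y+\chi_u)$, or (ii) there is $v\in\operatorname{supp}(y-x)$ with $g(x)+g(y)\ge g(x-\chi_u+\chi_v)+g(y+\chi_u-\chi_v)$. A point $x\in\operatorname{dom} g$ is Pareto optimal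 if there is no $y\in\operatorname{dom} g$ with $g(y)\le g(x)$, $\langle b,y\rangle\le\langle b,x\rangle$ and $(g(y),\langle b,y\rangle)\ne(g(x),\langle b,x\rangle)$. The Pareto optimal value set is $\{(g(x),\langle b,x\rangle)\mid x \text{ Pareto optimal}\}$. Running times are in the oracle model, with arithmetic operations and comparisons on function values at unit cost; parameters inside $O(\cdot)$ are understood to be at least $1$. *)

(* Defs.v *)
From HB Require Import structures.
From mathcomp Require Import all_boot all_order all_algebra.
From mathcomp Require Import classical_sets constructive_ereal reals.

Set Implicit Arguments.
Unset Strict Implicit.
Unset Printing Implicit Defensive.

Import Order.TTheory GRing.Theory Num.Theory.

Local Open Scope classical_set_scope.
Local Open Scope ring_scope.
Local Open Scope ereal_scope.

(** * M-natural-convex functions and Pareto optimality *)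

(* [{ffun E -> int}] is Z^E. *)

Section IntegerVectors.
Variable E : finType.
Implicit Types x b : {ffun E -> int}.

Definition chi (e : E) : {ffun E -> int} := [ffun f => (f == e)%:Z].

Definition supp x : pred E := [pred e | (0 < x e)%R].

Definition inner b x : int := (\sum_(e : E) b e * x e)%R.

Definition norm1 x : nat := (\sum_(e : E) `|x e|)%N.

Definition norminf x : nat := (\max_(e : E) `|x e|)%N.

Definition zero_one x : Prop := forall e, x e = 0%R \/ x e = 1%R.

End IntegerVectors.

Section Functions.
Variables (R : realType) (E : finType).
Implicit Types (g : {ffun E -> int} -> \bar R) (b x y : {ffun E -> int}).

Definition dom g : set {ffun E -> int} := [set x | g x \is a fin_num].

(* The first conjunct restricts the codomain [\bar R] to R U {+oo}. *)
Definition Mnat_convex g : Prop :=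
  [/\ forall x, g x != -oo,
      dom g !=set0 &
      forall x y, dom g x -> dom g y -> forall u, u \in supp (x - y)%R ->
        g (x - chi u)%R + g (y + chi u)%R <= g x + g y \/
        exists2 v, v \in supp (y - x)%R &
          g (x - chi u + chi v)%R + g (y + chi u - chi v)%R <= g x + g y].

Definition bounded_dom g : Prop :=
  exists B : nat, forall x, dom g x -> (norminf x <= B)%N.

Definition pareto_optimal g b x : Prop :=
  dom g x /\
  ~ exists y, [/\ dom g y, g y <= g x, (inner b y <= inner b x)%R &
                  (g y, inner b y) <> (g x, inner b x)].

Definition pareto_values g b : set (\bar R * int) :=
  [set (g x, inner b x) | x in pareto_optimal g b].

End Functions.

Definition is_max (S : set nat) (m : nat) : Prop :=
  S m /\ forall k, S k -> (k <= m)%N.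

(** * The oracle model

   A small imperative language over integers (with addition, subtraction and
   comparison) and function values (with the four arithmetic operations and
   comparison), having finitely many scalar variables and random-access arrays
   of each sort.  Every operation costs one unit, and an evaluation of [g] costs
   [T] further units.  Function values can influence the integers and the
   control flow only through comparisons, and programs contain no real constants.
   A program is one finite object, independent of R, E, g, b and the initial
   point. *)

Inductive iexp : Type :=
  | IConst of int
  | IVar of nat
  | IGet of nat & iexp
  | IAdd of iexp & iexp
  | ISub of iexp & iexp.

Inductive vexp : Type :=
  | VVar of nat
  | VGet of nat & iexp
  | VOfInt of iexp
  | VAdd of vexp & vexp
  | VSub of vexp & vexp
  | VMul of vexp & vexp
  | VDiv of vexp & vexp.

Inductive bexp : Type :=
  | ILe of iexp & iexp
  | VLe of vexp & vexp
  | BNot of bexp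
  | BAnd of bexp & bexp.

(* [Query v a] stores in value variable [v] the value of [g] at the vector held
   in integer array [a]; [Emit w i] appends the pair of values of [w] and [i] to
   the output. *)
Inductive cmd : Type :=
  | Skip
  | ISet of nat & iexp
  | IPut of nat & iexp & iexp
  | VSet of nat & vexp
  | VPut of nat & iexp & vexp
  | Query of nat & nat
  | Emit of vexp & iexp
  | Seq of cmd & cmd
  | If of bexp & cmd & cmd
  | While of bexp & cmd.

(* The cost of an expression is its number of operations and accesses; both
   arguments of [BAnd] are always evaluated. *)
Fixpoint icost (e : iexp) : nat :=
  match e with
  | IConst _ | IVar _ => 1
  | IGet _ i => (icost i).+1
  | IAdd e1 e2 | ISub e1 e2 => (icost e1 + icost e2).+1
  end.

Fixpoint vcost (e : vexp) : nat :=
  match e with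
  | VVar _ => 1
  | VGet _ i | VOfInt i => (icost i).+1
  | VAdd e1 e2 | VSub e1 e2 | VMul e1 e2 | VDiv e1 e2 =>
      (vcost e1 + vcost e2).+1
  end.

Fixpoint bcost (c : bexp) : nat :=
  match c with
  | ILe e1 e2 => (icost e1 + icost e2).+1
  | VLe e1 e2 => (vcost e1 + vcost e2).+1
  | BNot c1 => (bcost c1).+1
  | BAnd c1 c2 => (bcost c1 + bcost c2).+1
  end.

Definition upd (K : eqType) (A : Type) (f : K -> A) (k : K) (a : A) : K -> A :=
  fun k' => if k' == k then a else f k'.

Definition upd2 (A : Type) (f : nat -> int -> A) (k : nat) (i : int) (a : A) :
  nat -> int -> A := upd f k (upd (f k) i a).

Section Semantics.
Variable R : realType.

(* Scalar variables and arrays are named by natural numbers; array cells are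
   indexed by integers. *)
Record state : Type := State {
  ivar : nat -> int;
  iarr : nat -> int -> int;
  vvar : nat -> \bar R;
  varr : nat -> int -> \bar R;
  output : seq (\bar R * int) }.

Definition set_ivar s f := State f (iarr s) (vvar s) (varr s) (output s).
Definition set_iarr s f := State (ivar s) f (vvar s) (varr s) (output s).
Definition set_vvar s f := State (ivar s) (iarr s) f (varr s) (output s).
Definition set_varr s f := State (ivar s) (iarr s) (vvar s) f (output s).
Definition set_output s l := State (ivar s) (iarr s) (vvar s) (varr s) l.

Fixpoint ieval (s : state) (e : iexp) : int :=
  match e with
  | IConst z => z
  | IVar k => ivar s k
  | IGet a i => iarr s a (ieval s i)
  | IAdd e1 e2 => (ieval s e1 + ieval s e2)%R
  | ISub e1 e2 => (ieval s e1 - ieval s e2)%R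
  end.

Fixpoint veval (s : state) (e : vexp) : \bar R :=
  match e with
  | VVar k => vvar s k
  | VGet a i => varr s a (ieval s i)
  | VOfInt i => ((ieval s i)%:~R)%:E
  | VAdd e1 e2 => veval s e1 + veval s e2
  | VSub e1 e2 => veval s e1 - veval s e2
  | VMul e1 e2 => veval s e1 * veval s e2
  | VDiv e1 e2 => veval s e1 / veval s e2
  end.

Fixpoint beval (s : state) (c : bexp) : bool :=
  match c with
  | ILe e1 e2 => (ieval s e1 <= ieval s e2)%R
  | VLe e1 e2 => veval s e1 <= veval s e2
  | BNot c1 => ~~ beval s c1
  | BAnd c1 c2 => beval s c1 && beval s c2
  end.

Variables (E : finType) (g : {ffun E -> int} -> \bar R) (T : nat).

(* The coordinates of a vector are stored in cells 0, ..., #|E| - 1, in the order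
   in which [enum E] lists the elements of [E]. *)
Definition vector_of (a : int -> int) : {ffun E -> int} :=
  [ffun e => a (enum_rank e : nat)%:Z].

Definition array_of (x : {ffun E -> int}) : int -> int :=
  fun i => if i is Posz n then
             if insub n is Some j then x (enum_val (j : 'I_#|E|)) else 0%R
           else 0%R.

(* [exec c s s' t]: started in [s], command [c] halts in [s'] after time [t]. *)
Inductive exec : cmd -> state -> state -> nat -> Prop :=
  | ExecSkip s : exec Skip s s 1
  | ExecISet s k e :
      exec (ISet k e) s (set_ivar s (upd (ivar s) k (ieval s e))) (icost e).+1
  | ExecIPut s a i e :
      exec (IPut a i e) s
        (set_iarr s (upd2 (iarr s) a (ieval s i) (ieval s e)))
        (icost i + icost e).+1
  | ExecVSet s k e :
      exec (VSet k e) s (set_vvar s (upd (vvar s) k (veval s e))) (vcost e).+1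
  | ExecVPut s a i e :
      exec (VPut a i e) s
        (set_varr s (upd2 (varr s) a (ieval s i) (veval s e)))
        (icost i + vcost e).+1
  | ExecQuery s k a :
      exec (Query k a) s
        (set_vvar s (upd (vvar s) k (g (vector_of (iarr s a))))) T.+1
  | ExecEmit s w i :
      exec (Emit w i) s
        (set_output s (rcons (output s) (veval s w, ieval s i)))
        (vcost w + icost i).+1
  | ExecSeq c1 c2 s1 s2 s3 t1 t2 :
      exec c1 s1 s2 t1 -> exec c2 s2 s3 t2 -> exec (Seq c1 c2) s1 s3 (t1 + t2)
  | ExecIfTrue c c1 c2 s s' t :
      beval s c -> exec c1 s s' t -> exec (If c c1 c2) s s' (bcost c + t).+1
  | ExecIfFalse c c1 c2 s s' t :
      ~~ beval s c -> exec c2 s s' t -> exec (If c c1 c2) s s' (bcost c + t).+1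
  | ExecWhileTrue c c1 s1 s2 s3 t1 t2 :
      beval s1 c -> exec c1 s1 s2 t1 -> exec (While c c1) s2 s3 t2 ->
      exec (While c c1) s1 s3 (bcost c + t1 + t2).+1
  | ExecWhileFalse c c1 s :
      ~~ beval s c -> exec (While c c1) s s (bcost c).+1.

Lemma exec_det c s s1 t1 :
  exec c s s1 t1 -> forall s2 t2, exec c s s2 t2 -> s1 = s2 /\ t1 = t2.
Proof.
elim=> {c s s1 t1}.
all: try by move=> > H; inversion H.
- move=> c1 c2 s1 s2 s3 t1 t2 _ IH1 _ IH2 s' t' H; inversion H; subst.
  match goal with K : exec c1 _ _ _ |- _ => case: (IH1 _ _ K) => ? ?; subst end.
  by match goal with K : exec c2 _ _ _ |- _ => case: (IH2 _ _ K) => ? ?; subst end.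
- move=> c c1 c2 s s' t cT _ IH s2 t2 H; inversion H; subst.
    by match goal with K : exec _ _ _ _ |- _ => case: (IH _ _ K) => ? ?; subst end.
  by match goal with K : is_true (~~ _) |- _ => rewrite cT in K end.
- move=> c c1 c2 s s' t cF _ IH s2 t2 H; inversion H; subst.
    by match goal with K : is_true (beval _ _) |- _ => rewrite K in cF end.
  by match goal with K : exec c2 _ _ _ |- _ => case: (IH _ _ K) => ? ?; subst end.
- move=> c c1 s1 s2 s3 t1 t2 cT _ IH1 _ IH2 s' t' H; inversion H; subst.
    match goal with K : exec c1 _ _ _ |- _ => case: (IH1 _ _ K) => ? ?; subst end.
    by match goal with K : exec (While _ _) ?s _ ?t |- _ =>
      case: (IH2 _ _ K) => ? ?; subst end.
  by match goal with K : is_true (~~ _) |- _ => rewrite cT in K end.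
- move=> c c1 s cF s2 t2 H; inversion H; subst; last by [].
  by match goal with K : is_true (beval _ _) |- _ => rewrite K in cF end.
Qed.

(* Input: integer variable 0 holds #|E|, integer array 0 holds [b] and integer
   array 1 holds the initial point [x0]; everything else is zero. *)
Definition init_state (b x0 : {ffun E -> int}) : state :=
  State (upd (fun _ => 0%R) 0%N #|E|%:Z)
        (upd (upd (fun _ _ => 0%R) 0%N (array_of b)) 1%N (array_of x0))
        (fun _ => 0) (fun _ _ => 0) [::].

Definition computes_pareto_values_in
    (p : cmd) (b x0 : {ffun E -> int}) (bound : nat) : Prop :=
  exists (s : state) (t : nat),
    [/\ exec p (init_state b x0) s t,
        [set` output s] = pareto_values g b &
        (t <= bound)%N].

End Semantics.

(* Main.v *)
Require Import Defs.
From HB Require Import structures.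
From mathcomp Require Import all_boot all_order all_algebra.
From mathcomp Require Import boolp classical_sets constructive_ereal reals.
From mathcomp Require Import zify ring lra.

Set Implicit Arguments.
Unset Strict Implicit.
Unset Printing Implicit Defensive.

Import Order.TTheory GRing.Theory Num.Theory.

Local Open Scope classical_set_scope.

(** Call <b,x> the level of x.  The program works in two phases, and each phase
repeats one elementary search: among all x - chi_u + chi_v, where u and v range
over E together with a dummy that stands for no move, and where u must be
allowed to decrease and v allowed to increase, find a point of least value.
Such a scan costs at most (|E| + 1)^2 evaluations.

Phase one finds a minimizer of g by steepest descent.  A coordinate that has
once decreased may afterwards only decrease, and likewise for increases.  This
is harmless by the minimizer cut property [cone_cut]: if x - chi_u + chi_v is a
best neighbour, every y that respects the restrictions so far can be replaced by
a z that is no worse and moreover lies at or beyond that neighbour in the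
directions u and v.  When no allowed step improves, x is a minimizer ([cone_optimal]).  Since
all coordinates move monotonically, each step takes x further from the initial
point in the 1-norm, so the number of steps is at most the 1-norm diameter D of
dom g.

Phase two starts from that minimizer and goes down one level at a time, from an
optimal point x of its level to an optimal point of the next one.  An exchange
between x and a point one level lower shows that a best x - chi_u + chi_v with
b(u) = 1 and with b(v) = 0 or v the dummy is optimal on the next level
([next_level_optimal]), and that no lower level contains any point once all
these neighbours lie outside dom g ([lower_levels_empty]).  The value of level
<b,x> is Pareto optimal exactly when all these neighbours are worse than x
([level_optimal_pareto]); levels above the minimizer are dominated by it.  The
restriction on (u, v) has the same form as in phase one: elements with b = 1 may
only decrease, all others and the dummy only increase.  The number of levels is
again at most D + 1.

Altogether the time is O((D + 1) (|E| + 1)^2 (T + 1))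
([within_pareto_program]), with D <= |E| L in general and D <= 2 r when
dom g consists of 0-1 vectors.

The exchange arguments compare x with an arbitrary y, by induction on the 1-norm
distance of x and y or, in the minimizer cut, on the excess at one coordinate. *)

Local Open Scope ring_scope.

(** * Swaps of coordinates *)

Section Exchanges.
Variable E : finType.
Implicit Types (x y b : {ffun E -> int}) (o : option E).

(** [None] is the dummy element, at which nothing changes. *)
Definition unit_at o : {ffun E -> int} := if o is Some e then chi e else 0.

Definition swap x o o' : {ffun E -> int} := x - unit_at o + unit_at o'.

Definition at_opt b o : int := if o is Some e then b e else 0.

Lemma swapE x o o' e :
  swap x o o' e = x e - (o == Some e)%:Z + (o' == Some e)%:Z.
Proof.
rewrite /swap !ffunE; congr (_ - _ + _).
  by case: o => [f|] /=; rewrite !ffunE // eq_sym; congr Posz; congr nat_of_bool.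
by case: o' => [f|] /=; rewrite !ffunE // eq_sym; congr Posz; congr nat_of_bool.
Qed.

Lemma sub_ffunE x y e : (x - y) e = x e - y e.
Proof. by rewrite !ffunE. Qed.

Lemma inner_swap b x o o' :
  inner b (swap x o o') = inner b x - at_opt b o + at_opt b o'.
Proof.
have unitE p : \sum_e b e * (p == Some e)%:Z = at_opt b p.
  case: p => [a|] /=; last by apply: big1 => e _; rewrite mulr0.
  rewrite (bigD1 a) //= big1 => [|e ne]; first by rewrite eqxx mulr1 addr0.
  suff -> : Some a == Some e = false by rewrite mulr0.
  by apply: contraNF ne => /eqP [->].
rewrite /inner -!unitE -sumrB -big_split /=.
by apply: eq_bigr => e _; rewrite swapE mulrDr mulrBr.
Qed.

Lemma ltn_norm1 x y a :
  (forall e, absz (x e) <= absz (y e))%N -> (absz (x a) < absz (y a))%N ->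
  (norm1 x < norm1 y)%N.
Proof.
move=> le_xy lt_a; rewrite /norm1 (bigD1 a) //= [ltnRHS](bigD1 a) //=.
by rewrite -addSn leq_add // leq_sum.
Qed.

Lemma norm1_swap_closer x y o o' :
  (forall e, o = Some e -> x e < y e) -> (forall e, o' = Some e -> y e < x e) ->
  (o != None) || (o' != None) ->
  (norm1 (x - swap y o o')%R < norm1 (x - y)%R)%N.
Proof.
move=> Ho Ho'.
have dE e : (x - swap y o o') e = x e - y e + (o == Some e)%:Z - (o' == Some e)%:Z.
  by rewrite sub_ffunE swapE; ring.
have le_e e : (absz ((x - swap y o o')%R e) <= absz ((x - y)%R e))%N.
  rewrite dE sub_ffunE.
  have := Ho e; case: eqP => [Eo /(_ Eo)|_ _]; have := Ho' e;
    by case: eqP => [Eo' /(_ Eo')|_ _] /=; lia.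
case: o o' Ho Ho' dE le_e => [a|] [c|] Ho Ho' dE le_e //= _.
- apply: (ltn_norm1 (a := a) le_e); rewrite dE sub_ffunE eqxx; have := Ho a erefl; have := Ho' a.
  by case: eqP => [Eo' /(_ Eo')|_ _] /=; lia.
- apply: (ltn_norm1 (a := a) le_e); rewrite dE sub_ffunE eqxx.
  by have := Ho a erefl => /=; lia.
- apply: (ltn_norm1 (a := c) le_e); rewrite dE sub_ffunE eqxx.
  by have := Ho' c erefl => /=; lia.
Qed.

Lemma norm1_subC x y : norm1 (x - y) = norm1 (y - x).
Proof. by apply: eq_bigr => e _; rewrite !ffunE distnC. Qed.

Lemma lt_inner_exists b x y :
  zero_one b -> inner b y < inner b x -> exists2 u, b u = 1 & y u < x u.
Proof.
move=> b01 lt_yx.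
have [/existsP[u /andP[/eqP bu lt_u]]|/existsPn none] :=
  boolP [exists u, (b u == 1) && (y u < x u)]; first by exists u.
suff le_xy : inner b x <= inner b y by lia.
rewrite /inner ler_sum // => e _; have := none e.
by case: (b01 e) => -> /=; [rewrite !mul0r|rewrite !mul1r -leNgt].
Qed.

Lemma inner_leq_norm1 b x y :
  zero_one b -> inner b x - inner b y <= (norm1 (x - y))%:Z.
Proof.
move=> b01; rewrite /inner /norm1 -sumrB -natz natr_sum ler_sum // => e _.
rewrite sub_ffunE -mulrBr natz; case: (b01 e) => ->; lia.
Qed.

End Exchanges.

(** * The exchange property *)

Section ExtendedReals.
Variable R : realType.
Local Open Scope ereal_scope.
Implicit Types a b c d : \bar R.

(** The exchange inequality is used in this form: if one of its left-hand terms is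
no smaller than a term on the right, the remaining terms compare the other way. *)
Lemma lee_cancel a b c d :
  c \is a fin_num -> a + b <= c + d -> c <= a -> b <= d.
Proof.
case: c => // c _; case: a => [a||] //; case: b => [b||] //; case: d => [d||] //=;
  rewrite ?leey ?leNye // -?EFinD ?lee_fin; lra.
Qed.

Lemma lte_cancel a b c d :
  c \is a fin_num -> d \is a fin_num -> a + b <= c + d -> c < a -> b < d.
Proof.
case: c => // c _; case: d => // d _; case: a => [a||] //; case: b => [b||] //=;
  rewrite ?ltey ?ltNyr // -?EFinD ?lee_fin ?lte_fin; lra.
Qed.

End ExtendedReals.

Section MnatConvexFunctions.
Variables (R : realType) (E : finType) (g : {ffun E -> int} -> \bar R).
Hypothesis gM : Mnat_convex g.
Local Open Scope ereal_scope.
Implicit Types (x y : {ffun E -> int}) (o : option E).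

Lemma domE x : dom g x <-> g x < +oo.
Proof.
have [gNy _ _] := gM; rewrite /dom /=.
by have := gNy x; case: (g x) => // r; rewrite ltry.
Qed.

Lemma dom_le x y : dom g y -> g x <= g y -> dom g x.
Proof. by move=> /domE yd le_xy; apply/domE; apply: le_lt_trans yd. Qed.

Lemma exchange x y u : dom g x -> dom g y -> (y u < x u)%R ->
  exists2 o, forall v, o = Some v -> (x v < y v)%R &
    g (swap x (Some u) o) + g (swap y o (Some u)) <= g x + g y.
Proof.
move=> xd yd lt_u; have [_ _ ex] := gM.
have [|le_g|[v vs le_g]] := ex x y xd yd u.
- by rewrite inE sub_ffunE subr_gt0.
- by exists None => //; rewrite /swap /= addr0 subr0.
- exists (Some v); last by rewrite /swap /= [(y - _ + _)%R]addrAC.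
  by move=> w [<-]; move: vs; rewrite inE sub_ffunE subr_gt0.
Qed.

Lemma dom_exchange x y x' y' :
  dom g x -> dom g y -> g x' + g y' <= g x + g y -> dom g x' /\ dom g y'.
Proof.
move=> xd yd; have [gNy _ _] := gM; rewrite /dom /=.
move: xd yd (gNy x') (gNy y'); rewrite /dom /=.
by case: (g x) => // r _; case: (g y) => // s _; case: (g x') => [?||] //; case: (g y').
Qed.


(** For distinct points the exchange can be started from whichever of the two is
larger at a coordinate where they differ, which makes the result symmetric. *)
Lemma exchange_neq x y : dom g x -> dom g y -> x != y ->
  exists o o', [/\ (o != None) || (o' != None),
    forall e, o = Some e -> (y e < x e)%R, forall e, o' = Some e -> (x e < y e)%R &
    g (swap x o o') + g (swap y o' o) <= g x + g y].
Proof.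
move=> xd yd xNy.
have [e] : exists e, x e != y e.
  apply/existsP; apply: contraNT xNy; rewrite negb_exists => /forallP xy.
  by apply/eqP/ffunP => e; have := xy e; rewrite negbK => /eqP.
case: ltrgtP => // lt_e _.
- have [o Ho le_g] := exchange yd xd lt_e.
  exists o, (Some e); split=> //; first by rewrite orbT.
    by move=> f [<-].
  by rewrite addeC [leRHS]addeC.
- have [o Ho le_g] := exchange xd yd lt_e.
  by exists (Some e), o; split=> // f [<-].
Qed.

(** * Steepest descent with monotone coordinates *)

(** A positive entry of [F] at [e] says that [e] may only be increased, a negative
one that it may only be decreased. *)
Definition allowed (F : option E -> int) o o' := (F o <= 0)%R && (0 <= F o')%R.

Definition in_cone (F : option E -> int) x y := forall e,
  ((0 < F (Some e))%R -> (x e <= y e)%R) /\ ((F (Some e) < 0)%R -> (y e <= x e)%R).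

(** If y differs from x, a swap of x towards y stays in the cone, hence is allowed
and not better than x; the opposite swap of y is then no worse than y, and it is
closer to x. *)
Lemma cone_optimal F x :
  dom g x -> F None = 0%R -> (forall o o', allowed F o o' -> g x <= g (swap x o o')) ->
  forall y, dom g y -> in_cone F x y -> g x <= g y.
Proof.
move=> xd F0 opt y; move: {2}(norm1 (x - y)%R).+1 (ltnSn (norm1 (x - y)%R)) => m.
elim: m y => // m IH y; rewrite ltnS => le_m yd yK.
have [->//|xNy] := eqVneq x y.
have [o [o' [nN Ho Ho' le_g]]] := exchange_neq xd yd xNy.
have [_ y'd] := dom_exchange xd yd le_g.
have le_x : g x <= g (swap x o o').
  apply: opt; apply/andP; split.
    case: o Ho {le_g y'd nN} => [v|] Ho; last by rewrite F0.
    by have := Ho v erefl; have := (yK v).1; lia.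
  case: o' Ho' {le_g y'd nN} => [v|] Ho'; last by rewrite F0.
  by have := Ho' v erefl; have := (yK v).2; lia.
have lt_m : (norm1 (x - swap y o' o)%R < norm1 (x - y)%R)%N.
  by apply: norm1_swap_closer => //; rewrite orbC.
apply: (le_trans (IH _ (leq_trans lt_m le_m) y'd _)); last exact: lee_cancel le_g le_x.
move=> f; rewrite swapE; have [Kp Km] := yK f; split=> Ff.
  have := Kp Ff; case: (o' =P _) => [/Ho'|_]; case: (o =P _) => [/Ho|_] /=; lia.
have := Km Ff; case: (o =P _) => [/Ho|_]; case: (o' =P _) => [/Ho'|_] /=; lia.
Qed.

Definition mark (F : option E -> int) o o' : option E -> int := fun p =>
  if p is Some e then
    if o == p then (-1)%R else if o' == p then 1%R else F p
  else 0%R.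

(** This is the minimizer cut.  As long as y exceeds the best neighbour x' at o, an
exchange between y and x' at that coordinate turns x' into another allowed
neighbour of x (or into x itself), which is no better than x'; hence the
counterpart of y is no worse than y, and it is one unit lower at o.  The same
argument at o' raises y there and leaves y unchanged at o, since y does not
exceed x' at o. *)
Lemma cone_cut F x o o' :
  dom g x -> F None = 0%R -> o != o' -> allowed F o o' ->
  g (swap x o o') <= g x ->
  (forall p q, allowed F p q -> g (swap x o o') <= g (swap x p q)) ->
  forall y, dom g y -> in_cone F x y ->
  exists z, [/\ dom g z, g z <= g y & in_cone (mark F o o') (swap x o o') z].
Proof.
move=> xd F0 oNo' /andP[Fo Fo'] le_x opt.
set x' := swap x o o' in le_x opt *.
have x'd : dom g x' := dom_le xd le_x.
have x'E e : x' e = (x e - (o == Some e)%:Z + (o' == Some e)%:Z)%R by rewrite swapE.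
clearbody x'.
have down y : dom g y -> in_cone F x y -> exists z,
    [/\ dom g z, g z <= g y, in_cone F x z & forall u, o = Some u -> (z u < x u)%R].
  case: o oNo' Fo x'E => [u|] oNo' Fo x'E yd yK; last by exists y.
  move: {2}(absz (y u - x' u)%R).+1 (ltnSn (absz (y u - x' u)%R)) => m.
  elim: m y yd yK => // m IH y yd yK; rewrite ltnS => le_m.
  have x'u : x' u = (x u - 1)%R.
    by rewrite x'E eqxx eq_sym (negPf oNo') /= addr0.
  have [le_yx'|lt_u] := leP (y u) (x' u); first by exists y; split=> // w [<-]; lia.
  have [q Hq le_g] := exchange yd x'd lt_u.
  have [y'd _] := dom_exchange yd x'd le_g.
  have qu : (q == Some u) = false by apply/eqP => /Hq; lia.
  (* Restoring u in x' and lowering q instead gives the neighbour of x for (q, o'). *)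
  have le_y : g (swap y (Some u) q) <= g y.
    rewrite addeC [leRHS]addeC in le_g; apply: lee_cancel le_g _ => //.
    have -> : swap x' q (Some u) = swap x q o'.
      by apply/ffunP => e; rewrite !(swapE, x'E); lia.
    have [Eq|qNo'] := eqVneq q o'.
      suff -> : swap x q o' = x by [].
      by apply/ffunP => e; rewrite swapE Eq; lia.
    apply: opt; rewrite /allowed Fo' andbT.
    case: q qNo' Hq {y'd qu} => [w|] qNo' Hq; last by rewrite F0.
    have := Hq w erefl; rewrite x'E [o' == _]eq_sym (negPf qNo').
    by move=> /=; have := (yK w).1; lia.
  have [||z [zd le_zy zK zu]] := IH _ y'd.
  - move=> f; rewrite swapE; have [Kp Km] := yK f; split=> Ff.
      have := Kp Ff; case: (Some u =P _) => [[Ef]|_] /=; last by lia.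
      by subst f; lia.
    have := Km Ff; case: (q =P _) => [/Hq|_] /=; last by lia.
    rewrite x'E; case: (o' =P _) => [Eo'|_] /=; last by lia.
    by move: Fo'; rewrite Eo' leNgt Ff.
  - by apply: leq_trans le_m; rewrite swapE qu eqxx /=; lia.
  by exists z; split=> //; apply: le_trans le_y.
have up y : dom g y -> in_cone F x y -> (forall u, o = Some u -> (y u < x u)%R) ->
  exists z, [/\ dom g z, g z <= g y, in_cone F x z, 
    forall u, o = Some u -> (z u < x u)%R & forall v, o' = Some v -> (x v < z v)%R].
  case: o' oNo' Fo' x'E {down} => [v|] oNo' Fo' x'E yd yK yu; last by exists y.
  move: {2}(absz (y v - x' v)%R).+1 (ltnSn (absz (y v - x' v)%R)) => m.
  elim: m y yd yK yu => // m IH y yd yK yu; rewrite ltnS => le_m.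
  have x'v : x' v = (x v + 1)%R.
    by rewrite x'E eqxx (negPf oNo') /= subr0.
  have [le_x'y|lt_v] := leP (x' v) (y v); first by exists y; split=> // w [<-]; lia.
  have [q Hq le_g] := exchange x'd yd lt_v.
  have [_ y'd] := dom_exchange x'd yd le_g.
  have qv : (q == Some v) = false by apply/eqP => /Hq; lia.
  have qNo u : o = Some u -> (q == Some u) = false.
    move=> Eo; apply/eqP => /Hq; rewrite x'E Eo eqxx.
    by have := yu u Eo; lia.
  have le_y : g (swap y q (Some v)) <= g y.
    apply: lee_cancel le_g _ => //.
    have -> : swap x' (Some v) q = swap x o q.
      by apply/ffunP => e; rewrite !(swapE, x'E); lia.
    apply: opt; rewrite /allowed Fo /=.
    case: q qNo Hq {y'd qv} => [w|] qNo Hq; last by rewrite F0.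
    have := Hq w erefl; rewrite x'E; case: (o =P _) => [/qNo|_]; first by rewrite eqxx.
    by move=> /=; have := (yK w).2; lia.
  have [|||z [zd le_zy zK zu zv]] := IH _ y'd.
  - move=> f; rewrite swapE; have [Kp Km] := yK f; split=> Ff; last first.
      have := Km Ff; case: (Some v =P _) => [[Ef]|_] /=; last by lia.
      by subst f; lia.
    have := Kp Ff; case: (q =P _) => [Eq|_] /=; last by lia.
    have := Hq _ Eq; rewrite x'E; case: (o =P _) => [/qNo|_] /=; last by lia.
    by rewrite Eq eqxx.
  - move=> u Eo; rewrite swapE qNo //; have := yu u Eo.
    by case: (Some v =P _) => [Ev|_]; [rewrite Eo Ev eqxx in oNo'|lia].
  - by apply: leq_trans le_m; rewrite swapE qv eqxx /=; lia.
  by exists z; split=> //; apply: le_trans le_y.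
move=> y yd yK.
have [y1 [y1d le1 y1K y1u]] := down y yd yK.
have [z [zd lez zK zu zv]] := up y1 y1d y1K y1u.
exists z; split=> //; first exact: le_trans le1.
move=> e; rewrite /mark x'E; have [Kp Km] := zK e.
case: (o =P Some e) => [Eo|_] /=.
  have -> : (o' == Some e) = false by rewrite -Eo eq_sym (negPf oNo').
  by have := zu e Eo; split; lia.
case: (o' =P Some e) => [Eo'|_] /=; first by have := zv e Eo'; split; lia.
by rewrite subr0 addr0.
Qed.


(** * Exchanges between levels *)

Variable b : {ffun E -> int}.
Hypothesis b01 : zero_one b.

(** Read as the sign restriction of [allowed], this leaves exactly the swaps that
lower the level by one. *)
Definition lowering o : int := if o is Some e then (if b e == 1 then -1 else 1)%R else 1%R.

Definition level_optimal x :=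
  dom g x /\ forall y, dom g y -> inner b y = inner b x -> g x <= g y.

Lemma inner_allowed x o o' : allowed lowering o o' ->
  inner b (swap x o o') = (inner b x - 1)%R.
Proof.
rewrite /allowed inner_swap; case: o => [u|] //=; case: eqP => // -> /=.
by case: o' => [v|] /=; [case: (b01 v) => -> /=|]; rewrite ?eqxx /= ?addr0.
Qed.

(** An exchange started at a u with b(u) = 1 either keeps both levels, and then
brings y closer to x, or moves both points one level towards each other. *)
Lemma lower_exchange x y : dom g x -> dom g y -> (inner b y < inner b x)%R ->
  exists o o', [/\ (norm1 (x - swap y o' o)%R < norm1 (x - y)%R)%N,
    g (swap x o o') + g (swap y o' o) <= g x + g y &
    [/\ inner b (swap x o o') = inner b x & inner b (swap y o' o) = inner b y] \/
    allowed lowering o o' /\ inner b (swap y o' o) = (inner b y + 1)%R].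
Proof.
move=> xd yd lt_yx; have [u bu lt_u] := lt_inner_exists b01 lt_yx.
have [o Ho le_g] := exchange xd yd lt_u.
exists (Some u), o; split=> //.
  by apply: norm1_swap_closer => // [f [<-]|]; rewrite ?orbT.
rewrite !inner_swap /= bu /allowed /= bu eqxx.
case: o {Ho le_g} => [v|] /=; last by right; rewrite subr0.
by case: (b01 v) => -> /=; [right; rewrite subr0|left; rewrite !subrK].
Qed.

(** If the exchange keeps both levels, optimality of x makes the new y no worse,
and induction applies.  Otherwise the points trade levels: the new y lies on the
level of x, so it is no better than x, and the new x is an allowed neighbour
that is no worse than y. *)
Lemma next_level_optimal x w : level_optimal x ->
  (forall o o', allowed lowering o o' -> w <= g (swap x o o')) ->
  forall y, dom g y -> inner b y = (inner b x - 1)%R -> w <= g y.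
Proof.
move=> [xd xopt] opt y; move: {2}(norm1 (x - y)%R).+1 (ltnSn (norm1 (x - y)%R)) => m.
elim: m y => // m IH y; rewrite ltnS => le_m yd yl.
have [|o [o' [lt_m le_g kind]]] := lower_exchange xd yd; first by rewrite yl; lia.
have [x'd y'd] := dom_exchange xd yd le_g.
case: kind => [[x'l y'l]|[ok y'l]].
  apply: (le_trans (IH _ (leq_trans lt_m le_m) y'd _)); first by rewrite y'l.
  by apply: lee_cancel le_g _ => //; apply: xopt.
apply: le_trans (opt _ _ ok) _.
rewrite [leLHS]addeC in le_g.
by apply: lee_cancel le_g _ => //; apply: xopt => //; rewrite y'l yl subrK.
Qed.

(** This plays the part of convexity of the level minima: an exchange that moves x
to the worse next level must improve y, and brings it closer to x. *)
Lemma lower_levels_worse x : level_optimal x ->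
  (forall o o', allowed lowering o o' -> g x < g (swap x o o')) ->
  forall y, dom g y -> (inner b y < inner b x)%R -> g x < g y.
Proof.
move=> [xd xopt] opt y; move: {2}(norm1 (x - y)%R).+1 (ltnSn (norm1 (x - y)%R)) => m.
elim: m y => // m IH y; rewrite ltnS => le_m yd yl.
have [o [o' [lt_m le_g kind]]] := lower_exchange xd yd yl.
have [x'd y'd] := dom_exchange xd yd le_g.
case: kind => [[x'l y'l]|[ok y'l]].
  apply: (lt_le_trans (IH _ (leq_trans lt_m le_m) y'd _)); first by rewrite y'l.
  by apply: lee_cancel le_g _ => //; apply: xopt.
apply: le_lt_trans (lte_cancel _ _ le_g (opt _ _ ok)) => //.
have [lt_y'|ge_y'] := ltP (inner b (swap y o' o)) (inner b x).
  exact/ltW/(IH _ (leq_trans lt_m le_m)).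
by apply: xopt => //; lia.
Qed.

Lemma lower_levels_empty x : dom g x ->
  (forall o o', allowed lowering o o' -> ~ dom g (swap x o o')) ->
  forall y, dom g y -> (inner b x <= inner b y)%R.
Proof.
move=> xd none y; move: {2}(norm1 (x - y)%R).+1 (ltnSn (norm1 (x - y)%R)) => m.
elim: m y => // m IH y; rewrite ltnS => le_m yd.
rewrite leNgt; apply/negP => yl.
have [o [o' [lt_m le_g kind]]] := lower_exchange xd yd yl.
have [x'd y'd] := dom_exchange xd yd le_g.
case: kind => [[x'l y'l]|[ok _]]; last exact: none ok x'd.
by have := IH _ (leq_trans lt_m le_m) y'd; rewrite y'l; lia.
Qed.

Lemma level_optimal_pareto x v : level_optimal x ->
  pareto_values g b (v, inner b x) <->
  v = g x /\ forall o o', allowed lowering o o' -> g x < g (swap x o o').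
Proof.
move=> xopt; have [xd xmin] := xopt; split.
  move=> [z [zd zP] [<- zl]].
  have gz : g z = g x.
    apply/eqP; rewrite eq_le xmin // andbT leNgt; apply/negP => lt_xz.
    apply: zP; exists x; split=> //; [exact: ltW|by rewrite zl|].
    by move=> [gE]; rewrite gE ltxx in lt_xz.
  split=> // o o' ok; rewrite ltNge; apply/negP => le_x'.
  apply: zP; exists (swap x o o'); split; first exact: dom_le le_x'.
  - by rewrite gz.
  - by rewrite zl inner_allowed //; lia.
  - by case; rewrite zl inner_allowed //; lia.
move=> [-> better]; exists x => //; split=> // -[y [yd le_y yl neq]].
have [lt_l|ge_l] := ltP (inner b y) (inner b x).
  by have := lower_levels_worse xopt better yd lt_l; rewrite ltNge le_y.
have El : inner b y = inner b x by lia.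
by apply: neq; rewrite El; congr pair; apply/eqP; rewrite eq_le le_y xmin.
Qed.

End MnatConvexFunctions.

(** * The program *)

(* The three groups name integer variables, integer arrays and value variables.
   SIZE, COST and POINT are fixed by the input convention.  The dummy has index
   |E|: that cell of POINT is ignored by queries, and that of COST holds 0.  DOWN is negative
   when a scan has found no improvement. *)

Local Notation SIZE := 0%N.
Local Notation ROW := 1%N.
Local Notation COL := 2%N.
Local Notation DOWN := 3%N.
Local Notation UP := 4%N.
Local Notation LEVEL := 5%N.
Local Notation COST := 0%N.
Local Notation POINT := 1%N.
Local Notation SIGN := 2%N.
Local Notation VALUE := 0%N.
Local Notation BEST := 1%N.
Local Notation TRIAL := 2%N.

Definition move (i j : iexp) : cmd :=
  Seq (IPut POINT i (ISub (IGet POINT i) (IConst 1)))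
      (IPut POINT j (IAdd (IGet POINT j) (IConst 1))).

Definition record_trial : cmd :=
  If (VLe (VVar BEST) (VVar TRIAL)) Skip
     (Seq (VSet BEST (VVar TRIAL))
     (Seq (ISet DOWN (IVar ROW)) (ISet UP (IVar COL)))).

Definition try_swap : cmd :=
  Seq (move (IVar ROW) (IVar COL))
  (Seq (Query TRIAL POINT)
  (Seq (move (IVar COL) (IVar ROW)) record_trial)).

(** Rows and columns are traversed by a single loop, in lexicographic order. *)
Definition scan_body : cmd :=
  Seq (If (BAnd (ILe (IGet SIGN (IVar ROW)) (IConst 0))
                (ILe (IConst 0) (IGet SIGN (IVar COL))))
          try_swap Skip)
  (Seq (ISet COL (IAdd (IVar COL) (IConst 1)))
       (If (ILe (IVar COL) (IVar SIZE)) Skip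
          (Seq (ISet COL (IConst 0)) (ISet ROW (IAdd (IVar ROW) (IConst 1)))))).

Definition scan_init : cmd :=
  Seq (ISet ROW (IConst 0)) (Seq (ISet COL (IConst 0)) (ISet DOWN (IConst (-1)))).

Definition scan : cmd :=
  Seq scan_init (While (ILe (IVar ROW) (IVar SIZE)) scan_body).

Definition apply_best : cmd :=
  Seq (move (IVar DOWN) (IVar UP)) (VSet VALUE (VVar BEST)).

(** The last assignment undoes a possible marking of the dummy. *)
Definition descend_update : cmd :=
  If (ILe (IConst 0) (IVar DOWN))
     (Seq apply_best
     (Seq (IPut SIGN (IVar DOWN) (IConst (-1)))
     (Seq (IPut SIGN (IVar UP) (IConst 1))
          (IPut SIGN (IVar SIZE) (IConst 0)))))
     Skip.

Definition descend : cmd :=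
  Seq (Query VALUE POINT)
      (While (ILe (IConst 0) (IVar DOWN))
         (Seq (VSet BEST (VVar VALUE)) (Seq scan descend_update))).

Definition prepare_body : cmd :=
  Seq (If (ILe (IConst 1) (IGet COST (IVar ROW)))
          (Seq (ISet LEVEL (IAdd (IVar LEVEL) (IGet POINT (IVar ROW))))
               (IPut SIGN (IVar ROW) (IConst (-1))))
          (IPut SIGN (IVar ROW) (IConst 1)))
      (ISet ROW (IAdd (IVar ROW) (IConst 1))).

Definition prepare : cmd :=
  Seq (Seq (ISet ROW (IConst 0)) (ISet LEVEL (IConst 0)))
      (While (ILe (IVar ROW) (IVar SIZE)) prepare_body).

(** The quotient 1 / 0 is +oo, so only points of the domain can improve on it. *)
Definition lower_init : cmd :=
  VSet BEST (VDiv (VOfInt (IConst 1)) (VOfInt (IConst 0))).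

Definition lower_update : cmd :=
  Seq (If (VLe (VVar BEST) (VVar VALUE)) Skip (Emit (VVar VALUE) (IVar LEVEL)))
      (If (ILe (IConst 0) (IVar DOWN))
          (Seq apply_best (ISet LEVEL (ISub (IVar LEVEL) (IConst 1))))
          Skip).

Definition lower : cmd :=
  Seq (ISet DOWN (IConst 0))
      (While (ILe (IConst 0) (IVar DOWN))
         (Seq lower_init (Seq scan lower_update))).

Definition pareto_program : cmd := Seq descend (Seq prepare lower).

(** * Timed total correctness *)

Fixpoint loop_free (c : cmd) : bool :=
  match c with
  | Seq c1 c2 => loop_free c1 && loop_free c2
  | If _ c1 c2 => loop_free c1 && loop_free c2
  | While _ _ => false
  | _ => true
  end.

Section Correctness.
Variables (R : realType) (E : finType) (g : {ffun E -> int} -> \bar R) (T : nat).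
Implicit Types (o p q : option E) (s : state R) (c : cmd) (Q : state R -> Prop).

Fixpoint step c s : state R :=
  match c with
  | Skip => s
  | ISet k e => set_ivar s (upd (ivar s) k (ieval s e))
  | IPut a i e => set_iarr s (upd2 (iarr s) a (ieval s i) (ieval s e))
  | VSet k e => set_vvar s (upd (vvar s) k (veval s e))
  | VPut a i e => set_varr s (upd2 (varr s) a (ieval s i) (veval s e))
  | Query k a => set_vvar s (upd (vvar s) k (g (vector_of E (iarr s a))))
  | Emit w i => set_output s (rcons (output s) (veval s w, ieval s i))
  | Seq c1 c2 => step c2 (step c1 s)
  | If t c1 c2 => if beval s t then step c1 s else step c2 s
  | While _ _ => s
  end.

Fixpoint cost_bound c : nat :=
  match c with
  | Skip => 1
  | ISet _ e => (icost e).+1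
  | IPut _ i e => (icost i + icost e).+1
  | VSet _ e => (vcost e).+1
  | VPut _ i e => (icost i + vcost e).+1
  | Query _ _ => T.+1
  | Emit w i => (vcost w + icost i).+1
  | Seq c1 c2 => cost_bound c1 + cost_bound c2
  | If t c1 c2 => (bcost t + (cost_bound c1 + cost_bound c2)).+1
  | While _ _ => 0
  end.

(** A weakest precondition with a time bound. *)
Definition within N c s Q : Prop :=
  exists s' t, [/\ exec g T c s s' t, Q s' & (t <= N)%N].

Lemma within_weaken N N' c s Q Q' :
  within N c s Q -> (N <= N')%N -> (forall s', Q s' -> Q' s') -> within N' c s Q'.
Proof.
move=> [s' [t [ex Qs' le_t]]] le_N sub; exists s', t.
by split; [|exact: sub|exact: leq_trans le_N].
Qed.

Lemma within_seq N1 N2 c1 c2 s Q :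
  within N1 c1 s (fun s1 => within N2 c2 s1 Q) -> within (N1 + N2) (Seq c1 c2) s Q.
Proof.
move=> [s1 [t1 [ex1 [s2 [t2 [ex2 Qs2 le2]]] le1]]].
by exists s2, (t1 + t2)%N; split; [apply: ExecSeq ex1 ex2| |exact: leq_add].
Qed.

Lemma within_loop_free c s Q : loop_free c -> Q (step c s) -> within (cost_bound c) c s Q.
Proof.
have ex : loop_free c -> exists2 t, exec g T c s (step c s) t & (t <= cost_bound c)%N.
  elim: c s => //=; try by move=> *; eexists; [constructor|].
  - move=> c1 IH1 c2 IH2 s /andP[/(IH1 s)[t1 ex1 le1] /(IH2 (step c1 s))[t2 ex2 le2]].
    by exists (t1 + t2)%N; [apply: ExecSeq ex1 ex2|exact: leq_add].
  - move=> b c1 IH1 c2 IH2 s /andP[/(IH1 s)[t1 ex1 le1] /(IH2 s)[t2 ex2 le2]].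
    case: ifPn => bs.
      exists (bcost b + t1).+1; first exact: ExecIfTrue.
      by rewrite ltnS leq_add2l (leq_trans le1) ?leq_addr.
    exists (bcost b + t2).+1; first exact: ExecIfFalse.
    by rewrite ltnS leq_add2l (leq_trans le2) ?leq_addl.
by move=> /ex[t ext le_t] Qs; exists (step c s), t.
Qed.

(** The number [k] in the invariant bounds the remaining iterations. *)
Lemma within_while (I : nat -> state R -> Prop) N b c m s :
  (forall k s', I k s' -> beval s' b -> (0 < k)%N /\ within N c s' (I k.-1)) ->
  I m s ->
  within (m.+1 * (bcost b + N).+1) (While b c) s
    (fun s' => ~~ beval s' b /\ exists k, I k s').
Proof.
move=> step_I; elim: m s => [|m IH] s Is; have [bs|bs] := boolP (beval s b).
- by have [] := step_I _ _ Is bs.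
- exists s, (bcost b).+1; split; [exact: ExecWhileFalse|by split=> //; exists 0%N|].
  by rewrite mul1n ltnS leq_addr.
- have [_ [s1 [t1 [ex1 I1 le1]]]] := step_I _ _ Is bs.
  have [s2 [t2 [ex2 Q2 le2]]] := IH _ I1.
  exists s2, (bcost b + t1 + t2).+1; split=> //; first exact: ExecWhileTrue ex1 ex2.
  by rewrite mulSn addSn ltnS leq_add // leq_add2l.
- exists s, (bcost b).+1; split; [exact: ExecWhileFalse|by split=> //; exists m.+1|].
  by rewrite mulSn; apply: leq_trans (leq_addr _ _); rewrite ltnS leq_addr.
Qed.

(** * Vectors stored in arrays *)

Definition index (o : option E) : nat := if o is Some e then enum_rank e else #|E|.

Definition entry (A : Type) (a : int -> A) (o : option E) : A := a (index o)%:Z.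

Lemma index_le o : (index o <= #|E|)%N.
Proof. by case: o => [e|] /=; [apply: ltnW; apply: ltn_ord|]. Qed.

Lemma index_inj : injective index.
Proof.
move=> [e|] [f|] //=; first by move=> /val_inj/enum_rank_inj ->.
  by move=> ef; have := ltn_ord (enum_rank e); rewrite [X in (X < _)%N]ef ltnn.
by move=> ef; have := ltn_ord (enum_rank f); rewrite -[X in (X < _)%N]ef ltnn.
Qed.

Lemma index_onto i : (i <= #|E|)%N -> exists o, index o = i.
Proof.
rewrite leq_eqVlt => /orP[/eqP ->|lt_i]; first by exists None.
by exists (Some (enum_val (Ordinal lt_i))); rewrite /= enum_valK.
Qed.

Lemma vector_ofE (a : int -> int) e : vector_of E a e = entry a (Some e).
Proof. by rewrite ffunE. Qed.

Lemma entry_array_of (x : {ffun E -> int}) o : entry (array_of x) o = at_opt x o.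
Proof.
case: o => [e|]; rewrite /entry /array_of /=.
  by rewrite (valK (enum_rank e)) enum_rankK.
by rewrite insubF // ltnn.
Qed.

Lemma entry_upd (A : Type) (a : int -> A) p v o :
  entry (upd a (index p)%:Z v) o = if o == p then v else entry a o.
Proof. by rewrite /entry /upd eqz_nat (inj_eq index_inj). Qed.

(** The effect of [move] on the array of the current point. *)
Definition shifted (a : int -> int) (i j : int) : int -> int :=
  let a' := upd a i (a i - 1) in upd a' j (a' j + 1).

Lemma shiftedE a i j k : shifted a i j k = a k - (i == k)%:Z + (j == k)%:Z.
Proof.
rewrite /shifted /upd ![k == _]eq_sym; case: (j =P k) => [->|_]; last first.
  by case: (i =P k) => [->|_] /=; rewrite ?addr0 ?subr0.
by rewrite [k == i]eq_sym; case: (i =P k) => [->|_] /=; rewrite ?subr0.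
Qed.

Lemma shifted_back a i j : shifted (shifted a i j) j i = a.
Proof. by apply/funext => k; rewrite !shiftedE; lia. Qed.

Lemma vector_of_shifted a o o' :
  vector_of E (shifted a (index o) (index o')) = swap (vector_of E a) o o'.
Proof.
apply/ffunP => e; rewrite swapE !ffunE shiftedE !eqz_nat.
by rewrite !(inj_eq index_inj (_ : option E) (Some e)).
Qed.


(** * The scan *)

Definition point s : {ffun E -> int} := vector_of E (iarr s POINT).

Definition signs s : option E -> int := entry (iarr s SIGN).

Lemma step_move s a b :
  step (move (IVar a) (IVar b)) s =
  set_iarr s (upd (iarr s) POINT (shifted (iarr s POINT) (ivar s a) (ivar s b))).
Proof.
congr State => /=; apply/funext => k; rewrite /upd2 /upd /shifted.
by case: eqP.
Qed.

Lemma step_try_swap s o o' :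
  ivar s ROW = (index o)%:Z -> ivar s COL = (index o')%:Z ->
  let w := g (swap (point s) o o') in
  step try_swap s =
    if (vvar s BEST <= w)%E then set_vvar s (upd (vvar s) TRIAL w)
    else State (upd (upd (ivar s) DOWN (index o)%:Z) UP (index o')%:Z) (iarr s)
               (upd (upd (vvar s) TRIAL w) BEST w) (varr s) (output s).
Proof.
move=> sR sC w.
have tried : step (move (IVar COL) (IVar ROW))
    (step (Query TRIAL POINT) (step (move (IVar ROW) (IVar COL)) s)) =
    set_vvar s (upd (vvar s) TRIAL w).
  rewrite !step_move /= sR sC /set_iarr /set_vvar /= /upd /=; congr State.
    by apply/funext => k; case: eqP => // ->; rewrite shifted_back.
  by rewrite vector_of_shifted.
rewrite -[LHS]/(step record_trial (step (move (IVar COL) (IVar ROW))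
  (step (Query TRIAL POINT) (step (move (IVar ROW) (IVar COL)) s)))).
by rewrite tried /= /upd /= sR sC.
Qed.

(** [D] holds for the pairs tried so far, and [w0] is the value to be improved. *)
Definition scanned (D : option E -> option E -> Prop) (w0 : \bar R) F x s :=
  [/\ (vvar s BEST <= w0)%E,
      forall o o', D o o' -> allowed F o o' -> (vvar s BEST <= g (swap x o o'))%E &
      ivar s DOWN = -1 /\ vvar s BEST = w0 \/
      exists p q, [/\ ivar s DOWN = (index p)%:Z, ivar s UP = (index q)%:Z, allowed F p q,
        vvar s BEST = g (swap x p q) & (vvar s BEST < w0)%E]].

Definition same_data s0 s :=
  [/\ ivar s SIZE = ivar s0 SIZE, ivar s LEVEL = ivar s0 LEVEL, iarr s = iarr s0,
      vvar s VALUE = vvar s0 VALUE & output s = output s0].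

(** The lexicographic order of the scan, on indices below |E| + 1. *)
Definition before i j o o' : Prop := (index o * #|E|.+1 + index o' < i * #|E|.+1 + j)%N.

Lemma before_next o o' p q : before (index o) (index o').+1 p q ->
  before (index o) (index o') p q \/ p = o /\ q = o'.
Proof.
rewrite /before addnS ltnS leq_eqVlt => /orP[/eqP eq|]; last by left.
have lt_index r : (index r < #|E|.+1)%N by rewrite ltnS index_le.
right; split; apply: index_inj.
  have := congr1 (fun k => (k %/ #|E|.+1)%N) eq.
  by rewrite !divnMDl // !divn_small // !addn0.
have := congr1 (fun k => (k %% #|E|.+1)%N) eq.
by rewrite !modnMDl !modn_small.
Qed.

Lemma within_scan s : ivar s SIZE = #|E|%:Z ->
  within (200 * (#|E|.+1 ^ 2 * T.+1)) scan s (fun s' =>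
    same_data s s' /\ scanned (fun _ _ => True) (vvar s BEST) (signs s) (point s) s').
Proof.
move=> sN; set n := #|E| in sN *.
pose I m s' := exists i j, [/\ ivar s' ROW = i%:Z /\ ivar s' COL = j%:Z,
  (i <= n.+1)%N && (j <= n)%N, (i * n.+1 + j + m = n.+1 * n.+1)%N, same_data s s' &
  scanned (before i j) (vvar s BEST) (signs s) (point s) s'].
have I0 : I (n.+1 * n.+1)%N (step scan_init s).
  exists 0%N, 0%N; split=> //.
  by split=> //; left.
have loop : within (cost_bound scan_init +
    (n.+1 * n.+1).+1 * (bcost (ILe (IVar ROW) (IVar SIZE)) + cost_bound scan_body).+1)
    scan s (fun s' => ~~ beval s' (ILe (IVar ROW) (IVar SIZE)) /\ exists k, I k s').
  apply: within_seq; apply: within_loop_free => //.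
  apply: within_while I0 => m s' [i [j [[sR sC] /andP[_ le_j] le_m sD sS]]].
  have [sN' sL' sA' sV' sO'] := sD.
  rewrite /= sR sN' sN => le_i; have {}le_i : (i <= n)%N by lia.
  have m_gt0 : (0 < m)%N by nia.
  split=> //; apply: within_loop_free => //.
  have [o Eo] := index_onto le_i; have [o' Eo'] := index_onto le_j.
  have sAllowed : beval s' (BAnd (ILe (IGet SIGN (IVar ROW)) (IConst 0))
      (ILe (IConst 0) (IGet SIGN (IVar COL)))) = allowed (signs s) o o'.
    by rewrite /allowed /signs /entry /= sR sC sA' Eo Eo'.
  have sPoint : point s' = point s by rewrite /point sA'.
  pose s1 := if allowed (signs s) o o' then step try_swap s' else s'.
  have [[s1R s1C] s1D s1S] : [/\ ivar s1 ROW = i%:Z /\ ivar s1 COL = j%:Z, same_data s s1 &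
      scanned (before i j.+1) (vvar s BEST) (signs s) (point s) s1].
    have [le_w sS' sB] := sS; rewrite /s1; case: ifPn => [ok|notok]; last first.
      split=> //; split=> // p q; rewrite -{1}Eo -{1}Eo' => /before_next[|[-> ->] ok].
        by rewrite Eo Eo'; apply: sS'.
      by rewrite ok in notok.
    rewrite (@step_try_swap s' o o') ?sR ?sC ?Eo ?Eo' // sPoint.
    case: ifPn => [le_best|]; last rewrite -ltNge => lt_best.
      split=> //; split=> // p q; rewrite -{1}Eo -{1}Eo' => /before_next[|[-> ->] _ //].
      by rewrite Eo Eo'; apply: sS'.
    split=> //; split=> [|p q|].
    - by apply: le_trans le_w; apply: ltW.
    - rewrite -{1}Eo -{1}Eo' => /before_next[|[-> ->] _ //].
      by rewrite Eo Eo' => bf ok'; apply/ltW/(lt_le_trans lt_best)/sS'.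
    - by right; exists o, o'; rewrite /upd /= Eo Eo'; split=> //; apply: lt_le_trans le_w.
  rewrite -[step scan_body s']/(step (If (ILe (IVar COL) (IVar SIZE)) Skip
    (Seq (ISet COL (IConst 0)) (ISet ROW (IAdd (IVar ROW) (IConst 1)))))
    (step (ISet COL (IAdd (IVar COL) (IConst 1)))
      (if beval s' _ then step try_swap s' else s'))) sAllowed -/s1.
  have [s1N _ _ _ _] := s1D.
  rewrite [step (If _ _ _) _]/= /upd /= s1C s1N sN -/n.
  case: ifPn => [lt_j|ge_j].
    exists i, j.+1; split=> //=; lia.
  have Ej : j = n by lia.
  exists i.+1, 0%N; split=> //=; try lia.
  suff <- : before i j.+1 = before i.+1 0 by [].
  by rewrite Ej /before -/n (_ : i.+1 * n.+1 + 0 = i * n.+1 + n.+1)%N //; lia.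
apply: (within_weaken loop).
  rewrite -mulnn; have : (0 < n.+1 * n.+1)%N by [].
  by move: (n.+1 * n.+1)%N => W W_gt0; rewrite /=; have := leq_mul W_gt0 (leqnn T.+1); nia.
move=> s' [sR [m [i [j [[sR' sC] /andP[le_i le_j] le_m sD [le_w sS sB]]]]]].
split=> //; split=> // o o' _; apply: sS.
have [sN' _ _ _ _] := sD; move: sR; rewrite /= sR' sN' sN => /negP lt_i.
have := index_le o; have := index_le o'; rewrite /before -/n; nia.
Qed.


(** * The first phase *)

Lemma step_apply_best s p q :
  ivar s DOWN = (index p)%:Z -> ivar s UP = (index q)%:Z ->
  step apply_best s = State (ivar s)
    (upd (iarr s) POINT (shifted (iarr s POINT) (index p) (index q)))
    (upd (vvar s) VALUE (vvar s BEST)) (varr s) (output s).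
Proof.
move=> sD sU; rewrite -[LHS]/(step (VSet VALUE (VVar BEST))
  (step (move (IVar DOWN) (IVar UP)) s)).
by rewrite step_move sD sU.
Qed.

Lemma step_descend_update s p q : ivar s SIZE = #|E|%:Z ->
  ivar s DOWN = (index p)%:Z -> ivar s UP = (index q)%:Z -> p != q ->
  let s' := step descend_update s in
  [/\ ivar s' = ivar s /\ iarr s' COST = iarr s COST, point s' = swap (point s) p q,
      signs s' = mark (signs s) p q, vvar s' VALUE = vvar s BEST & output s' = output s].
Proof.
move=> sN sD sU pNq.
rewrite -[step descend_update s]/(if (0 <= ivar s DOWN) then
  step (Seq (IPut SIGN (IVar DOWN) (IConst (-1)))
       (Seq (IPut SIGN (IVar UP) (IConst 1))
            (IPut SIGN (IVar SIZE) (IConst 0)))) (step apply_best s) else s).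
rewrite sD le0z_nat (step_apply_best sD sU) /=; split=> //.
  by rewrite /point /upd2 /upd /= vector_of_shifted.
apply/funext => o; rewrite /signs /upd2 /= sN sD sU.
rewrite -[LHS]/(entry (upd (upd (upd (iarr s SIGN) (index p) (-1)) (index q) 1)
   (index None) 0) o) !entry_upd /mark.
case: o => //= e; rewrite ![Some e == _]eq_sym.
by case: (q =P _) => [Eq|//]; case: (p =P _) => [Ep|//]; rewrite Ep Eq eqxx in pNq.
Qed.

Variables (b x0 : {ffun E -> int}) (D : nat).
Hypotheses (gM : Mnat_convex g) (b01 : zero_one b) (x0d : dom g x0).
Hypothesis diam : forall x y, dom g x -> dom g y -> (norm1 (x - y)%R <= D)%N.

(** An unmarked coordinate still has its initial value. *)
Definition monotone_from_start F x :=
  in_cone F x0 x /\ forall e, F (Some e) = 0 -> x e = x0 e.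

Lemma monotone_swap F x p q : F None = 0 -> p != q -> allowed F p q ->
  monotone_from_start F x ->
  monotone_from_start (mark F p q) (swap x p q) /\
  (norm1 (x - x0)%R < norm1 (swap x p q - x0)%R)%N.
Proof.
move=> F0 pNq /andP[Fp Fq] [Fx Fx0]; split.
  split=> e; rewrite /mark swapE; have [Kp Km] := Fx e; have K0 := Fx0 e.
    case: (p =P Some e) => [Ep|_] /=.
      have -> : (q == Some e) = false by rewrite -Ep eq_sym (negPf pNq).
      rewrite Ep in Fp; split=> // _ /=; rewrite addr0.
      move: Fp; rewrite le_eqVlt => /orP[/eqP/K0 ->|/Km]; lia.
    case: (q =P Some e) => [Eq|_] /=; last by rewrite subr0 addr0.
    rewrite Eq in Fq; split=> // _; rewrite subr0.
    move: Fq; rewrite le_eqVlt => /orP[/eqP/esym/K0 ->|/Kp]; lia.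
  by case: (p == Some e) => //; case: (q == Some e) => // /K0 ->; rewrite subr0 addr0.
rewrite norm1_subC [ltnRHS]norm1_subC.
have {1}-> : x = swap (swap x p q) q p by apply/ffunP => e; rewrite !swapE; lia.
apply: norm1_swap_closer => [e Eq|e Ep|].
- rewrite Eq in Fq pNq *; rewrite swapE eqxx (negPf pNq) /= subr0.
  move: Fq; rewrite le_eqVlt => /orP[/eqP/esym/Fx0 ->|/(Fx e).1]; lia.
- rewrite Ep in Fp pNq *; rewrite swapE eqxx eq_sym (negPf pNq) /= addr0.
  move: Fp; rewrite le_eqVlt => /orP[/eqP/Fx0 ->|/(Fx e).2]; lia.
- by case: (q) (p) pNq => [?|] [?|].
Qed.

(** Every point has a counterpart in the cone that is no worse, so a minimizer
over the cone is a global one.  While the loop runs, [m] bounds the number of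
steps that the diameter leaves. *)
Definition descending s0 m s :=
  [/\ [/\ ivar s SIZE = #|E|%:Z, iarr s COST = iarr s0 COST & output s = output s0],
      vvar s VALUE = g (point s) /\ dom g (point s),
      signs s None = 0 /\ monotone_from_start (signs s) (point s),
      forall y, dom g y ->
        exists z, [/\ dom g z, (g z <= g y)%E & in_cone (signs s) (point s) z] &
      if 0 <= ivar s DOWN then (D < norm1 (point s - x0)%R + m)%N : Prop
      else forall o o', allowed (signs s) o o' -> (g (point s) <= g (swap (point s) o o'))%E].

Lemma within_descend s :
  ivar s SIZE = #|E|%:Z -> ivar s DOWN = 0 -> point s = x0 -> (forall o, signs s o = 0) ->
  within (1000 * (D.+1 * (#|E|.+1 ^ 2 * T.+1))) descend s (fun s' =>
    [/\ [/\ ivar s' SIZE = #|E|%:Z, iarr s' COST = iarr s COST & output s' = output s],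
        vvar s' VALUE = g (point s'), dom g (point s') &
        forall y, dom g y -> (g (point s') <= g y)%E]).
Proof.
move=> sN sD sP sS; set W := (_ ^ 2 * _)%N.
have I0 : descending s D.+1 (step (Query VALUE POINT) s).
  have eP : point (step (Query VALUE POINT) s) = x0 by [].
  have eS o : signs (step (Query VALUE POINT) s) o = 0 by apply: sS.
  split; rewrite ?eP ?eS //.
  - by split=> //; rewrite /= /upd /= -sP.
  - by move=> y yd; exists y; split=> // e; rewrite eS ltxx.
  - by rewrite /= sD /= subrr addnS ltnS leq_addl.
have loop : within (cost_bound (Query VALUE POINT) + D.+2 *
    (bcost (ILe (IConst 0) (IVar DOWN)) + (cost_bound (VSet BEST (VVar VALUE)) +
      (200 * W + cost_bound descend_update))).+1) descend s
   (fun s' => ~~ beval s' (ILe (IConst 0) (IVar DOWN)) /\ exists k, descending s k s').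
  apply: within_seq; apply: within_loop_free => //.
  apply: within_while I0 => m s1 Is1 /= goes.
  have [[s1N s1C s1O] [s1V s1d] [s1F s1M] s1I] := Is1; rewrite goes => s1m.
  have m_gt0 : (0 < m)%N by have := diam s1d x0d; lia.
  split=> //; apply: within_seq; apply: within_loop_free => //; apply: within_seq.
  apply: within_weaken (within_scan _) (leqnn _) _ => // s2 [[s2N s2L s2A s2V s2O] [_ s2S s2B]].
  apply: within_loop_free => //.
  have eP : point s2 = point s1 by rewrite /point s2A.
  have eS : signs s2 = signs s1 by rewrite /signs s2A.
  case: s2B => [[s2D s2W]|[p [q [s2D s2U ok s2W lt_W]]]].
    have -> : step descend_update s2 = s2 by rewrite /= s2D.
    split; rewrite ?eP ?eS ?s2D //=.
    - by rewrite s2N s2A s2O.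
    - by rewrite s2V.
    - by move=> o o' /s2S => /(_ I); rewrite s2W /= /upd /= s1V.
  have lt_x : (g (swap (point s1) p q) < g (point s1))%E.
    by move: lt_W; rewrite s2W /= /upd /= s1V.
  have pNq : p != q.
    apply/eqP => Epq; move: lt_x; rewrite Epq.
    suff -> : swap (point s1) q q = point s1 by rewrite ltxx.
    by apply/ffunP => e; rewrite swapE; lia.
  have [|[s3I s3C] s3P s3S s3V s3O] := @step_descend_update s2 p q _ s2D s2U pNq.
    by rewrite s2N.
  have [s3M s3m] := monotone_swap s1F pNq ok s1M.
  split; rewrite ?s3P ?s3S ?eP ?eS.
  - by rewrite s3I s3C s3O s2N s2A s2O.
  - by rewrite s3V s2W; split=> //; apply: dom_le s1d (ltW lt_x).
  - by [].
  - move=> y /s1I[z [zd le_z zK]].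
    have [|z' [z'd le_z' z'K]] := cone_cut gM s1d s1F pNq ok (ltW lt_x) _ zd zK.
      by move=> o o' /s2S => /(_ I); rewrite s2W.
    by exists z'; split=> //; apply: le_trans le_z.
  - by rewrite s3I s2D le0z_nat; lia.
apply: (within_weaken loop).
  have W_gt0 : (T.+1 <= W)%N by rewrite leq_pmull // expn_gt0.
  by rewrite /=; nia.
move=> s' [/= stops [m [[s'N s'C s'O] [s'V s'd] [s'F _] s'I s'm]]]; split=> // y.
move=> /s'I[z [zd le_z zK]].
apply: le_trans le_z; apply: (cone_optimal gM s'd s'F) zK => //.
by rewrite (negPf stops) in s'm.
Qed.


(** * The level of the minimizer *)

Definition partial_inner x i : int := \sum_(e | (index (Some e) < i)%N) b e * x e.

Lemma partial_innerS x o :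
  partial_inner x (index o).+1 = partial_inner x (index o) + at_opt [ffun e => b e * x e] o.
Proof.
rewrite /partial_inner; case: o => [e|] /=.
  rewrite (bigD1 e) ?ltnS //= ffunE addrC; congr (_ + _).
  apply: eq_bigl => f; rewrite [in RHS]ltn_neqAle ltnS andbC; congr (~~ _ && _).
  by apply/eqP/eqP => [->//|/val_inj/enum_rank_inj].
rewrite addr0; apply: eq_bigl => e; have := ltn_ord (enum_rank e); rewrite ltnS => lt_e.
by rewrite lt_e ltnW.
Qed.

Lemma within_prepare s : ivar s SIZE = #|E|%:Z -> iarr s COST = array_of b ->
  within (100 * (#|E|.+1 ^ 2 * T.+1)) prepare s (fun s' =>
    [/\ ivar s' SIZE = #|E|%:Z, ivar s' LEVEL = inner b (point s),
        point s' = point s, signs s' = lowering b &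
        vvar s' VALUE = vvar s VALUE /\ output s' = output s]).
Proof.
move=> sN sC; set n := #|E|.
pose I m s' := exists i, [/\ ivar s' ROW = i%:Z /\ (i + m = n.+1)%N,
  [/\ ivar s' SIZE = n, iarr s' COST = array_of b & iarr s' POINT = iarr s POINT],
  vvar s' VALUE = vvar s VALUE /\ output s' = output s,
  ivar s' LEVEL = partial_inner (point s) i &
  forall o, (index o < i)%N -> signs s' o = lowering b o].
have I0 : I n.+1 (step (Seq (ISet ROW (IConst 0)) (ISet LEVEL (IConst 0))) s).
  by exists 0%N; split=> //; rewrite /partial_inner big_pred0.
have loop : within (cost_bound (Seq (ISet ROW (IConst 0)) (ISet LEVEL (IConst 0))) +
    n.+2 * (bcost (ILe (IVar ROW) (IVar SIZE)) + cost_bound prepare_body).+1)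
    prepare s (fun s' => ~~ beval s' (ILe (IVar ROW) (IVar SIZE)) /\ exists k, I k s').
  apply: within_seq; apply: within_loop_free => //.
  apply: within_while I0 => m s1 [i [[s1R im] [s1N s1C s1P] s1V s1L s1S]].
  rewrite /= s1R s1N => le_i; have {}le_i : (i <= n)%N by lia.
  have m_gt0 : (0 < m)%N by lia.
  split=> //; apply: within_loop_free => //.
  have [o Eo] := index_onto le_i.
  have bE : array_of b i = at_opt b o by rewrite -entry_array_of /entry Eo.
  have xE : iarr s POINT i = if o is Some e then point s e else iarr s POINT i.
    by case: o Eo {bE} => // e <-; rewrite ffunE.
  rewrite /= s1R s1C bE.
  have signs_upd v p : (index p < i.+1)%N -> v = lowering b o ->
      upd2 (iarr s1) SIGN i v SIGN (index p) = lowering b p.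
    move=> lt_p Ev; rewrite /upd2 /upd /= eqz_nat; case: eqP => [Ep|Np].
      by rewrite Ev; congr lowering; apply: index_inj; rewrite Eo Ep.
    by apply: s1S; lia.
  exists i.+1; split=> /=.
  - by rewrite /upd; case: ifP => _ /=; rewrite s1R; split; lia.
  - by case: ifP.
  - by case: ifP.
  - rewrite -Eo partial_innerS Eo.
    case: ifPn => [b1|b0] /=; rewrite /upd /= s1L ?s1R ?s1P.
      congr (_ + _); case: o {Eo bE signs_upd} b1 xE => [e|//] /=; rewrite ffunE.
      by case: (b01 e) => -> //= _ ->; rewrite mul1r.
    rewrite -[LHS]addr0; congr (_ + _); case: o {Eo bE signs_upd xE} b0 => [e|//] /=; rewrite ffunE.
    by case: (b01 e) => -> //= _; rewrite mul0r.
  - move=> p lt_p; case: ifPn => [b1|b0]; rewrite /signs /entry /=.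
      rewrite [upd _ _ _ ROW]/upd /= s1R; apply: signs_upd => //.
      by case: o {Eo bE xE} b1 => [e|] //=; case: (b01 e) => ->.
    apply: signs_upd => //.
    by case: o {Eo bE xE} b0 => [e|] //=; case: (b01 e) => ->.
apply: (within_weaken loop).
  have : (n.+1 <= n.+1 ^ 2)%N by rewrite -mulnn leq_pmulr.
  have : (n.+1 ^ 2 <= n.+1 ^ 2 * T.+1)%N by rewrite leq_pmulr.
  by move: (n.+1 ^ 2 * T.+1)%N (n.+1 ^ 2)%N => W V; rewrite /=; lia.
move=> s' [/negP stops [m [i [[s'R im] [s'N s'C s'P] [s'V s'O] s'L s'S]]]].
have lt_n : (n < i)%N by move: stops; rewrite /= s'R s'N; lia.
split=> //.
- rewrite s'L; apply: eq_bigl => e.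
  by apply: leq_ltn_trans lt_n; apply: index_le.
- by rewrite /point s'P.
- by apply/funext => o; apply: s'S; apply: leq_ltn_trans lt_n; apply: index_le.
Qed.

(** * The second phase *)

(** While the loop runs, the output holds the Pareto optimal values above the
current level; the loop stops only after the lowest level has been treated. *)
Definition lowering_invariant k0 m s :=
  [/\ [/\ ivar s SIZE = #|E|%:Z, ivar s LEVEL = inner b (point s) & signs s = lowering b],
      vvar s VALUE = g (point s) /\ level_optimal g b (point s) &
      if 0 <= ivar s DOWN then
        (D%:Z < k0 - inner b (point s) + m%:Z) /\
        forall v k, (v, k) \in output s <-> pareto_values g b (v, k) /\ inner b (point s) < k
      else [set` output s] = pareto_values g b].

Lemma within_lower s :
  ivar s SIZE = #|E|%:Z -> ivar s LEVEL = inner b (point s) -> signs s = lowering b ->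
  vvar s VALUE = g (point s) -> output s = [::] -> dom g (point s) ->
  (forall y, dom g y -> (g (point s) <= g y)%E) ->
  within (1000 * (D.+1 * (#|E|.+1 ^ 2 * T.+1))) lower s (fun s' =>
    [set` output s'] = pareto_values g b).
Proof.
move=> sN sL sS sV sO sd smin; set W := (_ ^ 2 * _)%N; set k0 := inner b (point s).
have I0 : lowering_invariant k0 D.+1 (step (ISet DOWN (IConst 0)) s).
  split=> //; first by split=> //; split=> // y yd _; apply: smin.
  rewrite /= /upd /=; split; first by rewrite -/(point s) -/k0; lia.
  move=> v k; rewrite sO; split=> // -[[y [yd yP] [_ yk]] lt_k]; exfalso.
  apply: yP; exists (point s); split=> //; first exact: smin.
    by rewrite yk ltW.
  by move=> [_ Ek]; move: lt_k; rewrite -yk -Ek -[point _]/(point s) ltxx.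
have loop : within (cost_bound (ISet DOWN (IConst 0)) + D.+2 *
    (bcost (ILe (IConst 0) (IVar DOWN)) + (cost_bound lower_init +
      (200 * W + cost_bound lower_update))).+1) lower s
   (fun s' => ~~ beval s' (ILe (IConst 0) (IVar DOWN)) /\ exists k, lowering_invariant k0 k s').
  apply: within_seq; apply: within_loop_free => //.
  apply: within_while I0 => m s1 [[s1N s1L s1S] [s1V s1opt]] s1m /= goes.
  move: s1m; rewrite goes => -[s1m s1O].
  have s1d := s1opt.1.
  have m_gt0 : (0 < m)%N.
    have := inner_leq_norm1 (point s) (point s1) b01; have := diam sd s1d.
    rewrite -/k0; lia.
  split=> //; apply: within_seq; apply: within_loop_free => //; apply: within_seq.
  apply: within_weaken (within_scan _) (leqnn _) _ => // s2 [[s2N s2L s2A s2V s2O] [_ s2S s2B]].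
  apply: within_loop_free => //.
  have infty : vvar (step lower_init s1) BEST = +oo%E by rewrite /= /upd /= inve0 mul1e.
  have eP : point s2 = point s1 by rewrite /point s2A.
  have eS : signs s2 = signs s1 by rewrite /signs s2A.
  rewrite infty in s2B.
  have {}s2V : vvar s2 VALUE = g (point s1) by rewrite s2V.
  have {}s2L : ivar s2 LEVEL = inner b (point s1) by rewrite s2L.
  have {}s2N : ivar s2 SIZE = #|E|%:Z by rewrite s2N.
  have {}s2O : output s2 = output s1 by rewrite s2O.
  have opt o o' : allowed (lowering b) o o' -> (vvar s2 BEST <= g (swap (point s1) o o'))%E.
    by rewrite -s1S; apply: s2S.
  have better : (forall o o', allowed (lowering b) o o' -> g (point s1) < g (swap (point s1) o o'))%E
      <-> (g (point s1) < vvar s2 BEST)%E.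
    split=> [lt_x|lt_x o o' /opt]; last exact: lt_le_trans.
    case: s2B => [[_ ->]|[p [q [_ _ ok -> _]]]]; first exact/(domE gM).
    by apply: lt_x; rewrite -s1S.
  pose s3 := if (vvar s2 BEST <= vvar s2 VALUE)%E then s2
    else set_output s2 (rcons (output s2) (vvar s2 VALUE, ivar s2 LEVEL)).
  have s3O v k : (v, k) \in output s3 <-> pareto_values g b (v, k) /\ inner b (point s1) - 1 < k.
    have -> : (v, k) \in output s3 <-> (v, k) \in output s1 \/
        [/\ v = g (point s1), k = inner b (point s1) & (g (point s1) < vvar s2 BEST)%E].
      rewrite /s3 s2V /=; case: leP => [_|lt_x].
        by rewrite s2O; split=> [|[|[_ _ //]]]; first by left.
      rewrite /= mem_rcons inE s2O s2L; split=> [/orP[/eqP[-> ->]|]|[->|[-> -> _]]].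
      - by right.
      - by left.
      - by rewrite orbT.
      - by rewrite eqxx.
    rewrite s1O; split=> [[[vk lt_k]|[-> -> lt_x]]|[vk lt_k]].
    - by split=> //; lia.
    - by split; [apply/(level_optimal_pareto gM b01 _ s1opt); rewrite better|lia].
    - have [Ek|Nk] := eqVneq k (inner b (point s1)); last by left; split=> //; lia.
      right; rewrite Ek in vk *.
      by have [-> /better] := (level_optimal_pareto gM b01 _ s1opt).1 vk.
  have s3E : [/\ ivar s3 = ivar s2, iarr s3 = iarr s2, vvar s3 = vvar s2 & varr s3 = varr s2].
    by rewrite /s3; case: ifP.
  have [s3i s3a s3v _] := s3E.
  rewrite -[step lower_update s2]/(if (0 <= ivar s3 DOWN) then
    step (ISet LEVEL (ISub (IVar LEVEL) (IConst 1))) (step apply_best s3) else s3); clearbody s3.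
  case: s2B => [[s2D s2W]|[p [q [s2D s2U ok s2W lt_W]]]]; rewrite s3i s2D.
    have s3P : point s3 = point s1 by rewrite /point s3a s2A.
    rewrite /=; split; rewrite ?s3P.
    - by rewrite s3i s2N s2L /signs s3a s2A.
    - by rewrite s3v s2V.
    - rewrite s3i s2D /=; apply/seteqP; split=> -[v k] /=; first by move=> /s3O[].
      move=> vk; apply/s3O; split=> //.
      have [y [yd _] [_ <-]] := vk.
      suff : inner b (point s1) <= inner b y by lia.
      apply: (lower_levels_empty gM b01 s1d) yd => o o' /opt; rewrite s2W leye_eq => /eqP Ey.
      by rewrite /dom /= Ey.
  rewrite le0z_nat (@step_apply_best s3 p q) ?s3i //.
  have x'd : dom g (swap (point s1) p q) by apply/(domE gM); rewrite -s2W.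
  have x'l : inner b (swap (point s1) p q) = inner b (point s1) - 1.
    by apply: (inner_allowed b01); rewrite -s1S.
  set s4 := step _ _.
  have s4P : point s4 = swap (point s1) p q.
    by rewrite /point /s4 /= /upd /= s3a vector_of_shifted -/(point s2) eP.
  split.
  - split; rewrite ?s4P ?x'l.
    + by rewrite /= /upd /= s2N.
    + by rewrite /= /upd /= s2L.
    + by rewrite /signs /= /upd /= s3a -/(signs s2) eS.
  - rewrite s4P /= /upd /= s3v s2W; split=> //; split=> // y yd.
    rewrite x'l => yl; rewrite -s2W.
    exact: (next_level_optimal gM b01 s1opt opt) yd yl.
  - rewrite s4P /= /upd /= s2D le0z_nat x'l; split; [lia|exact: s3O].
apply: (within_weaken loop).
  have W_gt0 : (T.+1 <= W)%N by rewrite leq_pmull // expn_gt0.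
  by rewrite /=; nia.
by move=> s' [/= stops [m [_ _ s'm]]]; rewrite (negPf stops) in s'm.
Qed.


Lemma within_pareto_program :
  within (3000 * (D.+1 * (#|E|.+1 ^ 2 * T.+1))) pareto_program (init_state R b x0) (fun s =>
    [set` output s] = pareto_values g b).
Proof.
set W := (_ ^ 2 * _)%N.
have point0 : point (init_state R b x0) = x0.
  by apply/ffunP => e; rewrite vector_ofE; apply: entry_array_of.
have run : within (1000 * (D.+1 * W) + (100 * W + 1000 * (D.+1 * W))) pareto_program
    (init_state R b x0) (fun s => [set` output s] = pareto_values g b).
  apply: within_seq; apply: within_weaken (within_descend _ _ point0 _) (leqnn _) _ => //.
  move=> s1 [[s1N s1C s1O] s1V s1d s1min].
  apply: within_seq; apply: within_weaken (within_prepare s1N s1C) (leqnn _) _.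
  move=> s2 [s2N s2L s2P s2S [s2V s2O]].
  by apply: within_lower; rewrite ?s2P ?s2V ?s2O.
by apply: (within_weaken run) => //; nia.
Qed.

End Correctness.

(** * Bounds on the diameter and on the time *)

Section Sizes.
Variable E : finType.
Implicit Types x y : {ffun E -> int}.

Lemma norm1_leq_norminf x : (norm1 x <= #|E| * norminf x)%N.
Proof.
rewrite -sum_nat_const; apply: leq_sum => e _.
exact: (leq_bigmax (F := fun e => absz (x e))).
Qed.

Lemma norm1_leq_add x y : (norm1 (x - y)%R <= norm1 x + norm1 y)%N.
Proof.
rewrite /norm1 -big_split /=; apply: leq_sum => e _.
by rewrite sub_ffunE; lia.
Qed.

End Sizes.

Lemma scan_cost_leq n T :
  (n.+1 ^ 2 * T.+1 <= 8 * (maxn 1 n ^ 2 * maxn 1 T))%N.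
Proof.
have n_le : (n.+1 <= 2 * maxn 1 n)%N by lia.
have T_le : (T.+1 <= 2 * maxn 1 T)%N by lia.
rewrite (_ : 8 = 2 ^ 2 * 2)%N // mulnACA -expnMn.
by rewrite leq_mul // leq_exp2r.
Qed.

Lemma time_leq_box c n L T :
  (c * ((n * L).+1 * (n.+1 ^ 2 * T.+1)) <=
   c * 16 * (maxn 1 n ^ 3 * maxn 1 L * maxn 1 T))%N.
Proof.
rewrite -mulnA leq_mul2l; apply/orP; right.
have step_le : ((n * L).+1 <= 2 * (maxn 1 n * maxn 1 L))%N.
  rewrite mul2n -addnn -addn1 addnC leq_add ?muln_gt0 ?leq_max //.
  by rewrite leq_mul ?leq_maxr.
apply: leq_trans (leq_mul step_le (scan_cost_leq _ _)) _.
by move: (maxn 1 n) (maxn 1 L) (maxn 1 T) => n' l u; apply: eq_leq; ring.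
Qed.

Lemma time_leq_cube c n r T :
  (c * ((r + r).+1 * (n.+1 ^ 2 * T.+1)) <=
   c * 24 * (maxn 1 r * maxn 1 n ^ 2 * maxn 1 T))%N.
Proof.
rewrite -mulnA leq_mul2l; apply/orP; right.
have step_le : ((r + r).+1 <= 3 * maxn 1 r)%N by lia.
apply: leq_trans (leq_mul step_le (scan_cost_leq _ _)) _.
by move: (maxn 1 n) (maxn 1 r) (maxn 1 T) => n' k u; apply: eq_leq; ring.
Qed.

Local Close Scope ring_scope.

Theorem mainTheorem1 (R : realType) :
  (exists (p : cmd) (C : nat),
    forall (E : finType) (g : {ffun E -> int} -> \bar R)
           (b x0 : {ffun E -> int}) (L T : nat),
      Mnat_convex g -> bounded_dom g -> zero_one b -> dom g x0 ->
      is_max [set norminf (x - y)%R | x in dom g & y in dom g] L ->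
      computes_pareto_values_in g T p b x0
        (C * (maxn 1 #|E| ^ 3 * maxn 1 L * maxn 1 T)))
  /\
  (exists (p : cmd) (C : nat),
    forall (E : finType) (g : {ffun E -> int} -> \bar R)
           (b x0 : {ffun E -> int}) (r T : nat),
      Mnat_convex g -> bounded_dom g -> zero_one b -> dom g x0 ->
      (forall x, dom g x -> zero_one x) ->
      is_max [set norm1 x | x in dom g] r ->
      computes_pareto_values_in g T p b x0
        (C * (maxn 1 r * maxn 1 #|E| ^ 2 * maxn 1 T))).
Proof.
split; exists pareto_program.
  exists (3000 * 16)%N => E g b x0 L T gM _ b01 x0d [_ maxL].
  have diam x y : dom g x -> dom g y -> (norm1 (x - y)%R <= #|E| * L)%N.
    move=> xd yd; apply: leq_trans (norm1_leq_norminf _) _.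
    by rewrite leq_mul2l maxL ?orbT //; exists x => //; exists y.
  have [s [t [ex out le_t]]] := within_pareto_program T gM b01 x0d diam.
  by exists s, t; split=> //; apply: leq_trans le_t (time_leq_box _ _ _ _).
exists (3000 * 24)%N => E g b x0 r T gM _ b01 x0d _ [_ maxr].
have diam x y : dom g x -> dom g y -> (norm1 (x - y)%R <= r + r)%N.
  move=> xd yd; apply: leq_trans (norm1_leq_add _ _) _.
  by rewrite leq_add // maxr //; [exists x|exists y].
have [s [t [ex out le_t]]] := within_pareto_program T gM b01 x0d diam.
by exists s, t; split=> //; apply: leq_trans le_t (time_leq_cube _ _ _ _).
Qed.
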